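(* Let $n,d\ge1$, let $\mathcal{S}$ be a subspace of $\mathbb{R}^{nd}$, let $\lambda_-\le\lambda_+$ be in $(-1,1)$, and let $I=\{1,\dots,K\}$. A set of pairs $\{(\mathbf{x}^k,\mathbf{y}^k)\}_{k\in I}$ with $\mathbf{x}^k,\mathbf{y}^k\in\mathbb{R}^{nd}$ is $\mathcal{M}^{\mathcal{S}}_{\lambda_-,\lambda_+}$-interpolable, i.e. there exists $M\in\mathcal{M}^{\mathcal{S}}_{\lambda_-,\lambda_+}$ with $\mathbf{y}^k=M\mathbf{x}^k$ for all $k\in I$, if and only if $$\bar X=\bar Y,\qquad (Y_\perp-\lambda_-X_\perp)^T(Y_\perp-\lambda_+X_\perp)\preceq 0,\qquad X_\perp^TY_\perp=Y_\perp^TX_\perp,$$ where $X=[\mathbf{x}^1\dots\mathbf{x}^K]$, $Y=[\mathbf{y}^1\dots\mathbf{y}^K]\in\mathbb{R}^{nd\times K}$, $\bar X,\bar Y$ are obtained by orthogonally projecting each column of $X,Y$ onto $\mathcal{S}$, and $X_\perp=X-\bar X$, $Y_\perp=Y-\bar Y$ are the projections onto the orthogonal complement $\mathcal{S}^\perp$.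
   Context: $\mathcal{M}^{\mathcal{S}}_{\lambda_-,\lambda_+}$ is the set of symmetric matrices $M\in\mathbb{R}^{nd\times nd}$ such that $\lambda_1(M)=\dots=\lambda_{|\mathcal{S}|}(M)=1$ with corresponding eigenvectors forming a basis of $\mathcal{S}$ (where $|\mathcal{S}|$ is the dimension of $\mathcal{S}$), and the remaining eigenvalues satisfy $\lambda_-\le\lambda_{nd}(M)\le\dots\le\lambda_{|\mathcal{S}|+1}(M)\le\lambda_+$. *)

(* Defs.v *)
From HB Require Import structures.
From mathcomp Require Import all_boot all_order all_algebra.
From mathcomp Require Export reals.
Set Implicit Arguments. Unset Strict Implicit. Unset Printing Implicit Defensive.
Import Order.TTheory GRing.Theory Num.Theory.
Local Open Scope ring_scope.

(* A subspace S of R^N is represented by a matrix whose ROW SPACE is S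
   (MathComp's mxalgebra convention); its dimension |S| is \rank S.
   Vectors of R^N are column vectors 'cV_N; a column x lies in S iff
   (x^T <= S)%MS. *)

Definition orthproj (R : realType) (N : nat) (S : 'M[R]_N) : 'M[R]_N :=
  let B := row_base S in (B^T *m invmx (B *m B^T)) *m B.

Definition nsd (R : realType) (K : nat) (A : 'M[R]_K) : Prop :=
  forall v : 'cV[R]_K, (v^T *m A *m v) 0 0 <= 0.

Definition MS (R : realType) (N : nat) (S : 'M[R]_N) (lm lp : R)
  (M : 'M[R]_N) : Prop :=
  M^T = M /\
  exists (U : 'M[R]_N) (lam : 'rV[R]_N),
    U^T *m U = 1%:M /\
    M = U *m diag_mx lam *m U^T /\
    (forall i j : 'I_N, (i <= j)%N -> lam 0 j <= lam 0 i) /\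
    (forall i : 'I_N, (i < \rank S)%N -> lam 0 i = 1) /\
    ((\sum_(i < N | (i < \rank S)%N) <<(col i U)^T>>)%MS == S)%MS /\
    (forall i : 'I_N, (\rank S <= i)%N -> lm <= lam 0 i <= lp).

Definition interpolable (R : realType) (N K : nat) (S : 'M[R]_N) (lm lp : R)
  (X Y : 'M[R]_(N, K)) : Prop :=
  exists M : 'M[R]_N, MS S lm lp M /\ forall k : 'I_K, col k Y = M *m col k X.

(* Main.v *)
(* Necessity is read off the spectral decomposition of M: M commutes with the
   orthogonal projection P onto S, and on the complement the quadratic form is
   the sum of (lam_i - lm) (lam_i - lp) z_i^2.

   For sufficiency put A = Yp - lm Xp and G = Xp^T A.  The two conditions say
   that G is symmetric and A^T A <= (lp - lm) G, so Q = A G^+ A^T satisfies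
   Q Xp = A and Q^2 <= (lp - lm) Q, whence its eigenvalues lie in [0, lp - lm]
   (this also covers lm = lp).  Then M = P + lm (1 - P) + Q interpolates.  As
   lp < 1, its eigenvalue-1 eigenspace is exactly S, so sorting the eigenvalues
   puts a basis of S first; their number is rank S because tr P = rank S. *)
Require Import Defs.
From mathcomp Require Import all_boot all_order all_algebra reals.
From mathcomp Require Import fingroup perm.
From mathcomp Require Import complex ring lra.
Set Implicit Arguments. Unset Strict Implicit. Unset Printing Implicit Defensive.
Import Order.TTheory GRing.Theory Num.Theory.
Local Open Scope ring_scope.

(** * Squared norms and the spectral theorem for real symmetric matrices *)

Lemma eq_col (R : Type) m n (A B : 'M[R]_(m, n)) :
  (forall j, col j A = col j B) -> A = B.
Proof.
by move=> eqAB; apply/matrixP => i j; have /colP/(_ i) := eqAB j; rewrite !mxE.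
Qed.

Lemma dotmxE (R : realDomainType) n (v : 'cV[R]_n) :
  (v^T *m v) 0 0 = \sum_i v i 0 ^+ 2.
Proof. by rewrite mxE; apply: eq_bigr => i _; rewrite mxE expr2. Qed.

Lemma dotmx_ge0 (R : realDomainType) n (v : 'cV[R]_n) : 0 <= (v^T *m v) 0 0.
Proof. by rewrite dotmxE; apply: sumr_ge0 => i _; rewrite sqr_ge0. Qed.

Lemma dotmx_eq0 (R : realDomainType) n (v : 'cV[R]_n) :
  ((v^T *m v) 0 0 == 0) = (v == 0).
Proof.
rewrite dotmxE psumr_eq0 => [|i _]; last exact: sqr_ge0.
apply/allP/eqP => [v0 | -> i _]; last by rewrite mxE expr0n eqxx.
apply/colP => i; rewrite mxE.
by apply/eqP; have := v0 i (mem_index_enum i); rewrite /= sqrf_eq0.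
Qed.

(** Over [R[i]] the matrix is Hermitian, so its spectral values are real; being roots of the
    characteristic polynomial, which has coefficients in [R], they are eigenvalues over [R]. *)
Lemma symmetric_eigenvalue (R : rcfType) n (A : 'M[R]_n.+1) :
  A^T = A -> exists a, eigenvalue A a.
Proof.
move=> symA; pose toC := (real_complex R : R -> R[i]).
pose AC := map_mx toC A.
have hA : AC \is hermsymmx.
  apply/is_hermitianmxP; rewrite expr0 scale1r.
  apply/matrixP => i j; rewrite !mxE -[in LHS]symA mxE.
  by rewrite conj_Creal //; apply/complex_realP; exists (A j i).
have /mxOverP spR := hermitian_spectral_diag_real hA.
have [a aE] := complex_realP _ (spR 0 0).
exists a.
rewrite eigenvalue_root_char -(fmorph_root toC) map_char_poly -/AC.
rewrite -eigenvalue_root_char.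
suff: eigenvalue AC (spectral_diag AC 0 0) by rewrite aE.
have /hermitian_normalmx /orthomx_spectralP AE := hA.
have Pu := spectral_unit AC; set P := spectralmx AC in AE Pu.
(* [eigenvalue] refers to row vectors, so the eigenvector is a row of the diagonalizing matrix,
   nonzero because that matrix is invertible. *)
apply/eigenvalueP; exists (row 0 P); last first.
  apply/eqP => r0; have /rowP/(_ 0) : row 0 P *m invmx P = 0.
    by rewrite r0 mul0mx.
  by rewrite rowE -mulmxA mulmxV // mulmx1 !mxE !eqxx => /eqP; rewrite oner_eq0.
rewrite {1}AE mulmxA -row_mul mulmxA mulmxV // mul1mx.
by rewrite row_diag_mx -scalemxAl -rowE.
Qed.

(* Reflection along w = u - e_0; when u = e_0 the junk value 0^-1 = 0 makes it
   the identity. *)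
Lemma householder (R : realFieldType) n (u : 'cV[R]_n.+1) :
  (u^T *m u) 0 0 = 1 ->
  exists2 Q : 'M[R]_n.+1, Q^T *m Q = 1%:M & col 0 Q = u.
Proof.
move=> u1; pose w := u - delta_mx 0 0; pose c := (w^T *m w) 0 0.
have wE : w^T *m w = c%:M by rewrite /c -mx11_scalar.
have symw : (w *m w^T)^T = w *m w^T by rewrite trmx_mul trmxK.
(* Both [u] and e_0 are unit vectors. Hence the inner product of [w] and e_0 is -c/2, and for
   nonzero [c] the reflection sends e_0 to e_0 + w = u. *)
have cE : c = - (2 * (u 0 0 - 1)).
  rewrite /c /w [(u - _)^T]linearB /= mulmxBl !mulmxBr trmx_delta -!rowE -colE.
  by rewrite [u^T *m u]mx11_scalar u1 !mxE !eqxx /=; ring.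
exists (1%:M - (2 / c) *: (w *m w^T)).
  rewrite [(_ - _)^T]linearB /= [(_ *: _)^T]linearZ /= trmx1 symw.
  rewrite mulmxBl !mulmxBr mul1mx mulmx1 mul1mx -!scalemxAr -!scalemxAl mulmxA.
  rewrite -(mulmxA w) wE mul_mx_scalar.
  rewrite -scalemxAl !scalerA; have -> : 2 / c * (2 / c) * c = 2 / c + 2 / c.
    have [->|c0] := eqVneq c 0; first by rewrite invr0 !mulr0 addr0.
    by field.
  by rewrite scalerDl opprB addrK subrK.
rewrite colE mulmxBl mul1mx -scalemxAl -mulmxA.
have -> : w^T *m delta_mx 0 0 = (u 0 0 - 1)%:M.
  by rewrite [LHS]mx11_scalar -colE !mxE eqxx.
have [c0|c0] := eqVneq c 0; last first.
  rewrite mul_mx_scalar scalerA -mulrA (_ : _ * _ = -1).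
    by rewrite scaleN1r opprK addrC subrK.
  by rewrite mulrCA -[2 * _]opprK -cE mulrN mulVf.
have /eqP := c0; rewrite dotmx_eq0 => /eqP w0.
by rewrite w0 mul0mx scaler0 subr0; apply/esym/eqP; rewrite -subr_eq0 -/w w0.
Qed.

(** Deflation: conjugating by an orthogonal matrix whose first column is a unit eigenvector clears
    the first column off the diagonal, by symmetry also the first row, and induction handles the
    remaining block. *)
Lemma symmetric_spectral (R : rcfType) n (A : 'M[R]_n) : A^T = A ->
  exists U : 'M[R]_n, exists lam : 'rV[R]_n,
    U^T *m U = 1%:M /\ A = U *m diag_mx lam *m U^T.
Proof.
elim: n A => [|n IH] A symA.
  by exists 1%:M, 0; split; apply/matrixP; case.
have [a /eigenvalueP[v0 vA v_neq0]] := symmetric_eigenvalue symA.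
pose c := (v0 *m v0^T) 0 0.
have c_gt0 : 0 < c.
  have := dotmx_ge0 v0^T; have := dotmx_eq0 v0^T.
  by rewrite lt0r trmxK -/c trmx_eq0 => -> ->; rewrite v_neq0.
pose u := (Num.sqrt c)^-1 *: v0^T.
have u1 : (u^T *m u) 0 0 = 1.
  rewrite [u^T]linearZ /= trmxK -scalemxAl -scalemxAr scalerA mxE -/c.
  by rewrite -expr2 exprVn sqr_sqrtr ?ltW // mulVf ?gt_eqF.
have Au : A *m u = a *: u.
  by rewrite -scalemxAr -[in LHS]symA -trmx_mul vA linearZ /= scalerA mulrC
    scalerA.
have [Q Q1 Qu] := householder u1.
pose B : 'M_(1 + n) := Q^T *m A *m Q.
have Q1' : Q *m Q^T = 1%:M by exact: mulmx1C.
have symB : B^T = B by rewrite !trmx_mul trmxK symA mulmxA.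
have B0 : col 0 B = a *: delta_mx 0 0.
  rewrite colE -mulmxA -colE Qu -mulmxA Au -scalemxAr -Qu colE mulmxA Q1 mul1mx.
  by [].
have dl0 : dlsubmx B = 0.
  apply/matrixP => i j; rewrite ord1 !mxE.
  have -> : lshift n (0 : 'I_1) = (0 : 'I_n.+1) by exact: val_inj.
  have /colP/(_ (rshift 1 i)) := B0; rewrite !mxE => ->.
  by rewrite mulr0.
have ur0 : ursubmx B = 0.
  by rewrite -symB -trmx_dlsub dl0 trmx0.
have [U' [lam' [U1 BE]]] := IH (drsubmx B) ltac:(by rewrite trmx_drsub symB).
pose U0 : 'M_(1 + n) := block_mx 1%:M 0 0 U'.
pose lam : 'rV_(1 + n) := row_mx (ulsubmx B) lam'.
have BE2 : B = U0 *m diag_mx lam *m U0^T.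
  rewrite -[LHS]submxK dl0 ur0 BE diag_mx_row tr_block_mx !mulmx_block.
  rewrite !trmx1 !trmx0 !mul1mx !mulmx1 !mul0mx !mulmx0 !addr0 !add0r.
  congr block_mx; rewrite ?mul0mx ?addr0 ?add0r //.
  by rewrite [LHS]mx11_scalar [RHS]mx11_scalar !mxE.
have U01 : U0^T *m U0 = 1%:M.
  rewrite tr_block_mx mulmx_block U1 !trmx1 !trmx0 !mul1mx !mul0mx !mulmx0.
  by rewrite !addr0 !add0r -scalar_mx_block.
exists (Q *m U0), lam; split.
  by rewrite trmx_mul mulmxA -(mulmxA _ Q^T) Q1 mulmx1.
rewrite trmx_mul mulmxA -(mulmxA Q) -(mulmxA Q) -BE2.
by rewrite /B !mulmxA Q1' mul1mx -mulmxA Q1' mulmx1.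
Qed.

Lemma sorted_spectral (R : rcfType) n (A : 'M[R]_n) : A^T = A ->
  exists U : 'M[R]_n, exists lam : 'rV[R]_n,
    [/\ U^T *m U = 1%:M, A = U *m diag_mx lam *m U^T &
      forall i j : 'I_n, (i <= j)%N -> lam 0 j <= lam 0 i].
Proof.
move=> symA; have [V [mu [V1 AE]]] := symmetric_spectral symA.
pose t := [tuple mu 0 i | i < n].
have /tuple_permP[s sE] : perm_eq (sort_tuple >=%R t) t by rewrite perm_sort.
pose lam : 'rV_n := \row_i mu 0 (s i).
have lamE i : lam 0 i = (sort >=%R t)`_i.
  by rewrite sE (nth_map i) ?size_enum_ord // nth_ord_enum tnth_mktuple mxE.
exists (col_perm s V), lam; split.
- apply/matrixP => i j; have /matrixP/(_ (s i) (s j)) := V1.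
  by rewrite !mxE (inj_eq perm_inj) => <-; apply: eq_bigr => k _; rewrite !mxE.
- apply/matrixP => i j; rewrite AE !mul_mx_diag !mxE.
  rewrite (reindex_inj (@perm_inj _ s)).
  by apply: eq_bigr => k _; rewrite !mxE.
move=> i j ij; rewrite !lamE.
have sz : size (sort >=%R t) = n by rewrite size_sort size_tuple.
apply: (sorted_leq_nth (leT := >=%R)) => //; rewrite ?inE ?sz //.
- exact: ge_trans.
- exact: ge_refl.
- by apply: sort_sorted => x y; exact: ge_total.
Qed.

(** * Pseudo-inverse and symmetric completion *)

Lemma symmetric_pinv (R : rcfType) n (G : 'M[R]_n) : G^T = G ->
  exists H : 'M[R]_n, [/\ H^T = H, G *m H *m G = G & H *m G *m H = H].
Proof.
move=> symG; have [V [g [V1 GE]]] := symmetric_spectral symG.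
have dd (a b : 'rV[R]_n) : (V *m diag_mx a *m V^T) *m (V *m diag_mx b *m V^T)
    = V *m diag_mx (\row_i (a 0 i * b 0 i)) *m V^T.
  by rewrite -mulmx_diag !mulmxA -(mulmxA _ V^T) V1 mulmx1.
(* The convention [0^-1 = 0] makes entrywise inversion of the eigenvalues the pseudo-inverse. *)
exists (V *m diag_mx (\row_i (g 0 i)^-1) *m V^T); split.
- by rewrite !trmx_mul trmxK tr_diag_mx mulmxA.
- rewrite GE !dd; congr (_ *m diag_mx _ *m _); apply/rowP => i; rewrite !mxE.
  by have [->|g0] := eqVneq (g 0 i) 0; rewrite ?mulr0 // divff // mul1r.
- rewrite GE !dd; congr (_ *m diag_mx _ *m _); apply/rowP => i; rewrite !mxE.
  have [->|g0] := eqVneq (g 0 i) 0; first by rewrite invr0 mulr0.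
  by rewrite mulVf // mul1r.
Qed.

(* The completion is A G^+ A^T with G = X^T A, the minimal positive semidefinite
   solution P of P X = A; the bound A^T A <= delta G yields P^2 <= delta P. *)
Lemma contractive_completion (R : rcfType) N K
    (X A : 'M[R]_(N, K)) (delta : R) :
  A^T *m X = X^T *m A ->
  (forall v : 'cV_K, (v^T *m (A^T *m A) *m v) 0 0
     <= delta * (v^T *m (X^T *m A) *m v) 0 0) ->
  exists2 C : 'M[R]_(K, N), A *m C *m X = A /\ (A *m C)^T = A *m C &
  forall w : 'cV_N, ((A *m C *m w)^T *m (A *m C *m w)) 0 0
     <= delta * (w^T *m (A *m C) *m w) 0 0.
Proof.
move=> symG; set G := X^T *m A => leG.
have symG' : G^T = G by rewrite trmx_mul trmxK.
have [H [symH GHG HGH]] := symmetric_pinv symG'.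
exists (H *m A^T); first split.
- rewrite -!mulmxA symG -/G; apply/eqP; rewrite eq_sym -subr_eq0; apply/eqP.
  (* [T] maps into the kernel of [G]. For [v] in that kernel the bound reads |Av|^2 <= 0, so [A]
     kills the range of [T]. *)
  pose T := 1%:M - H *m G.
  have GT : G *m T = 0 by rewrite mulmxBr mulmx1 mulmxA GHG subrr.
  have -> : A - A *m (H *m G) = A *m T by rewrite mulmxBr mulmx1.
  apply: eq_col => j; rewrite [RHS]col0 colE -mulmxA.
  have : G *m (T *m delta_mx j 0) = 0 :> 'cV_K by rewrite mulmxA GT mul0mx.
  move: (T *m delta_mx j 0) => v Gv.
  apply/eqP; rewrite -dotmx_eq0 eq_le dotmx_ge0 andbT.
  have := leG v; rewrite -(mulmxA v^T G v) Gv mulmx0.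
  by rewrite [(0 : 'M_1) 0 0]mxE mulr0 trmx_mul !mulmxA.
- by rewrite !trmx_mul trmxK symH mulmxA.
(* At this vector both sides become forms in [w], and [H *m G *m H = H] collapses the right-hand
   one. *)
move=> w; have := leG (H *m A^T *m w).
by rewrite !trmx_mul !trmxK symH !mulmxA -(mulmxA _ X^T) -/G
  -(mulmxA (w^T *m A) H G) -(mulmxA (w^T *m A)) HGH.
Qed.

(** * The orthogonal projection onto a row space *)

Section OrthogonalProjection.
Variables (R : realType) (N : nat) (S : 'M[R]_N).
Let B := row_base S.
Let P := orthproj S.

(** If v C C^T = 0 then |vC|^2 = 0, so vC = 0 and freeness gives v = 0. *)
Lemma gram_unit m (C : 'M[R]_(m, N)) : row_free C -> C *m C^T \in unitmx.
Proof.
move=> freeC; rewrite -row_free_unit; apply: inj_row_free => v vC0.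
apply/eqP; rewrite -(mulmx_free_eq0 _ freeC) -trmx_eq0 -dotmx_eq0.
by rewrite trmxK trmx_mul mulmxA -(mulmxA v) vC0 mul0mx mxE.
Qed.

Let unitB : B *m B^T \in unitmx.
Proof. exact/gram_unit/row_base_free. Qed.

Lemma orthproj_tr : P^T = P.
Proof.
by rewrite /P /orthproj -/B trmx_mul (trmx_mul B^T) trmxK trmx_inv
  (trmx_mul B) trmxK mulmxA.
Qed.

Let BP : B *m P = B.
Proof. by rewrite /P /orthproj -/B !mulmxA mulmxV // mul1mx. Qed.

Lemma orthproj_idem : P *m P = P.
Proof. by rewrite {1}/P /orthproj -/B -(mulmxA _ B P) BP. Qed.

Lemma orthproj_sub : (P <= S)%MS.
Proof. by rewrite -(eq_row_base S) submxMl. Qed.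

Lemma orthproj_trace : \tr P = (\rank S)%:R.
Proof.
by rewrite /P /orthproj -/B -mulmxA mxtrace_mulC -mulmxA mulVmx // mxtrace1.
Qed.

Lemma orthproj_id (x : 'cV[R]_N) : (x^T <= S)%MS -> P *m x = x.
Proof.
rewrite -(eq_row_base S) => /submxP[D xE]; apply: trmx_inj.
by rewrite trmx_mul orthproj_tr xE -mulmxA BP.
Qed.

Lemma orthproj_id_sub (x : 'cV[R]_N) : P *m x = x -> (x^T <= S)%MS.
Proof.
move=> <-; rewrite trmx_mul orthproj_tr.
exact: submx_trans (submxMl _ _) orthproj_sub.
Qed.

Lemma orthproj_eq0 (x : 'cV[R]_N) : S *m x = 0 -> P *m x = 0.
Proof.
move=> Sx; have /submxP[D ->] := orthproj_sub.
by rewrite -mulmxA Sx mulmx0.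
Qed.

Lemma sub_orthproj : (S <= P)%MS.
Proof. by rewrite -{1}(eq_row_base S) -/B -BP submxMl. Qed.
End OrthogonalProjection.

(** * Necessity: spectral consequences of [MS] *)

Lemma mulmx_diag_eigen (R : comNzRingType) n (P U : 'M[R]_n) (b : 'rV[R]_n) :
  (forall i, P *m col i U = b 0 i *: col i U) -> P *m U = U *m diag_mx b.
Proof.
move=> PU; apply/matrixP => i j; have /colP/(_ i) := PU j.
rewrite mul_mx_diag !mxE mulrC => <-; apply: eq_bigr => k _.
by rewrite !mxE.
Qed.

Lemma col_mul_diag (R : comNzRingType) n (U : 'M[R]_n) (lam : 'rV[R]_n) i :
  U^T *m U = 1%:M -> U *m diag_mx lam *m U^T *m col i U = lam 0 i *: col i U.
Proof.
move=> U1; rewrite !colE mulmxA -(mulmxA _ U^T) U1 mulmx1 mul_mx_diag.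
by apply/colP => k; rewrite -!colE !mxE mulrC.
Qed.

Lemma dot_col (R : comNzRingType) n (U : 'M[R]_n) i j :
  U^T *m U = 1%:M -> (col i U)^T *m col j U = (i == j)%:R%:M.
Proof.
move=> U1; rewrite [LHS]mx11_scalar; congr _%:M.
have /matrixP/(_ i j) := U1; rewrite !mxE => <-.
by apply: eq_bigr => k _; rewrite !mxE.
Qed.

(** Both sides agree on the orthonormal columns of [U]: the leading ones span [S], and the others
    are orthogonal to these, hence to [S]. *)
Lemma MS_orthproj (R : realType) N (S U : 'M[R]_N) :
  U^T *m U = 1%:M ->
  ((\sum_(i < N | (i < \rank S)%N) <<(col i U)^T>>)%MS == S)%MS ->
  orthproj S = U *m diag_mx (\row_i (i < \rank S)%:R) *m U^T.
Proof.
move=> U1 /andP[sub_S S_sub].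
rewrite -[LHS]mulmx1 -(mulmx1C U1) mulmxA; congr (_ *m _).
apply: mulmx_diag_eigen => i; rewrite mxE; case: ltnP => ir.
  rewrite scale1r; apply: orthproj_id; apply: submx_trans sub_S.
  by rewrite (sumsmx_sup i) ?genmxE.
rewrite scale0r; apply: orthproj_eq0; apply/sub_kermxP.
apply: submx_trans S_sub _; apply/sumsmx_subP => j jr.
rewrite genmxE; apply/sub_kermxP; rewrite dot_col //.
case: eqP => [ji|_]; last by rewrite raddf0.
by move: jr; rewrite ji ltnNge ir.
Qed.

Lemma orthproj_mulMS (R : realType) N (S M : 'M[R]_N) lm lp :
  MS S lm lp M -> orthproj S *m M = orthproj S /\ M *m orthproj S = orthproj S.
Proof.
case=> symM [U [lam [U1 [ME [_ [lam1 [span _]]]]]]].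
have PM : M *m orthproj S = orthproj S.
  rewrite (MS_orthproj U1 span) ME !mulmxA -(mulmxA _ U^T) U1.
  rewrite mulmx1 -(mulmxA U) mulmx_diag; congr (_ *m diag_mx _ *m _).
  apply/rowP => i; rewrite !mxE; case: ltnP => ir; last by rewrite mulr0.
  by rewrite lam1 // mulr1.
split=> //; apply: trmx_inj.
by rewrite trmx_mul symM orthproj_tr.
Qed.

Lemma MS_quadratic_le0 (R : realType) N (S M : 'M[R]_N) lm lp (w : 'cV[R]_N) :
  MS S lm lp M -> orthproj S *m w = 0 ->
  ((M *m w - lm *: w)^T *m (M *m w - lp *: w)) 0 0 <= 0.
Proof.
case=> _ [U [lam [U1 [ME [_ [_ [span lamb]]]]]]] Pw.
pose z := U^T *m w; have wE : w = U *m z by rewrite mulmxA (mulmx1C U1) mul1mx.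
have shiftE c : M *m w - c *: w = U *m (\col_i ((lam 0 i - c) * z i 0)).
  rewrite ME -mulmxA -/z {1}wE scalemxAr -mulmxA -mulmxBr; congr (_ *m _).
  by apply/colP => i; rewrite mul_diag_mx !mxE mulrBl.
(* Orthogonality to [S] removes the coordinates with eigenvalue 1, the only ones where the bounds
   [lm], [lp] fail. *)
have z0 (i : 'I_N) : (i < \rank S)%N -> z i 0 = 0.
  move=> ir; have /(congr1 (mulmx U^T)) := Pw; rewrite (MS_orthproj U1 span).
  rewrite !mulmxA U1 mul1mx -mulmxA -/z mulmx0 => /colP/(_ i).
  by rewrite mul_diag_mx !mxE ir mul1r.
clearbody z; rewrite !shiftE trmx_mul mulmxA -(mulmxA _ U^T) U1 mulmx1 mxE.
apply: sumr_le0 => i _; rewrite !mxE; have [ir|ir] := ltnP i (\rank S).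
  by rewrite z0 // !mulr0.
have /andP[l1 l2] := lamb i ir.
rewrite mulrACA -expr2 mulr_le0_ge0 ?sqr_ge0 //.
by rewrite mulr_ge0_le0 ?subr_ge0 ?subr_le0.
Qed.

(** * Sufficiency: recognizing and building members of [MS] *)

Lemma mem_down_closed n (T : {set 'I_n}) :
  (forall i j : 'I_n, (j <= i)%N -> i \in T -> j \in T) ->
  forall i : 'I_n, (i \in T) = (i < #|T|)%N.
Proof.
move=> downT i; apply/idP/idP => [iT|]; last apply: contraLR => iT.
  rewrite -[X in (X <= _)%N]card_ord.
  (* The [i.+1] indices up to and including [i] all embed in [T]; for the converse, [T] embeds in
     the [i] indices below [i]. *)
  rewrite -(card_imset predT (f := widen_ord (ltn_ord i))); last first.
    by move=> j k /(congr1 val) jk; apply: val_inj.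
  apply/subset_leq_card/subsetP => _ /imsetP[j _ ->].
  by apply: downT iT; rewrite /= -ltnS.
rewrite -leqNgt -[X in (_ <= X)%N]card_ord.
apply: leq_trans (leq_imset_card (widen_ord (ltnW (ltn_ord i))) predT).
apply/subset_leq_card/subsetP => j jT; have ji : (j < i)%N.
  by rewrite ltnNge; apply: contra iT => ij; apply: downT jT.
by apply/imsetP; exists (Ordinal ji) => //; apply: val_inj.
Qed.

(** Reduces membership to eigenvalue bounds on the complement of [S]. Since PM = P, an eigenvector
    with eigenvalue other than 1 is orthogonal to [S]; one with eigenvalue 1 lies in [S]. *)
Lemma eigen_MS (R : realType) N (S M : 'M[R]_N) lm lp :
  M^T = M -> M *m orthproj S = orthproj S -> lp < 1 ->
  (forall (u : 'cV_N) a, u != 0 -> orthproj S *m u = 0 -> M *m u = a *: u ->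
     lm <= a <= lp) ->
  MS S lm lp M.
Proof.
move=> symM MP lp1 eigM; set P := orthproj S in MP eigM.
have PM : P *m M = P by apply: trmx_inj; rewrite trmx_mul symM orthproj_tr.
have [U [lam [U1 ME lam_mono]]] := sorted_spectral symM.
have Mu i : M *m col i U = lam 0 i *: col i U by rewrite ME col_mul_diag.
have u_neq0 i : col i U != 0.
  have := dot_col i i U1; apply: contra_eq_neq => ->; rewrite mulmx0 eqxx.
  by rewrite eq_sym oner_eq0.
pose b : 'rV[R]_N := \row_i (lam 0 i == 1)%:R.
have colP i : (lam 0 i != 1 -> lm <= lam 0 i <= lp) /\
    P *m col i U = b 0 i *: col i U.
  have PMu : (1 - lam 0 i) *: (P *m col i U) = 0.
    by rewrite scalerBl scale1r scalemxAr -Mu mulmxA PM subrr.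
  rewrite mxE; have [l1|l1] /= := eqVneq (lam 0 i) 1.
    split=> //; rewrite scale1r; apply/eqP.
    rewrite eq_sym -subr_eq0; apply/negPn/negP => t0.
    (* A nonzero u - Pu would be an eigenvector for 1 in the complement, contradicting [lp < 1]. *)
    have : lm <= 1 <= lp.
      apply: (eigM _ _ t0); rewrite mulmxBr mulmxA ?orthproj_idem ?subrr //.
      by rewrite MP Mu l1 !scale1r.
    by rewrite [1 <= _]leNgt lp1 andbF.
  have Pu0 : P *m col i U = 0.
    by move/eqP: PMu; rewrite scaler_eq0 subr_eq0 eq_sym (negPf l1) => /eqP.
  by rewrite scale0r; split=> // _; apply: (eigM _ _ (u_neq0 i)).
have PE : P = U *m diag_mx b *m U^T.
  rewrite -[LHS]mulmx1 -(mulmx1C U1) mulmxA; congr (_ *m _).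
  by apply: mulmx_diag_eigen => i; case: (colP i).
(* Both numbers are the trace of [P]. As the eigenvalues are sorted and at most 1, this count fixes
   the positions of the 1s. *)
have rankE : \rank S = #|[set i | lam 0 i == 1]|.
  apply/eqP; rewrite -(eqr_nat R) -orthproj_trace -/P PE mxtrace_mulC mulmxA U1.
  rewrite mul1mx mxtrace_diag -sum1_card natr_sum; apply/eqP.
  rewrite [RHS]big_mkcond /=.
  by apply: eq_bigr => i _; rewrite inE mxE; case: ifP.
have lam_le1 i : lam 0 i <= 1.
  have [->//|/(proj1 (colP i))/andP[_ l2]] := eqVneq (lam 0 i) 1.
  exact/ltW/(le_lt_trans l2).
have lam1E (i : 'I_N) : (lam 0 i == 1) = (i < \rank S)%N.
  rewrite rankE -mem_down_closed ?inE // => k j jk; rewrite !inE => /eqP lk.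
  by rewrite eq_le lam_le1 -lk lam_mono.
split=> //.
exists U, lam; split; [by []|split; [by []|split; [by []|split; [|split]]]].
- by move=> i; rewrite -lam1E => /eqP.
- apply/andP; split.
    apply/sumsmx_subP => i; rewrite -lam1E genmxE => /eqP l1.
    by apply: orthproj_id_sub; rewrite (proj2 (colP i)) mxE l1 eqxx scale1r.
  apply: submx_trans (sub_orthproj S) _; rewrite -/P PE.
  apply/row_subP => k; rewrite row_mul mulmx_sum_row; apply: summx_sub => i _.
  rewrite mul_mx_diag !mxE; have [l1|_] := eqVneq (lam 0 i) 1; last first.
    by rewrite mulr0 scale0r sub0mx.
  apply: scalemx_sub; apply: (sumsmx_sup i); first by rewrite -lam1E l1.
  by rewrite genmxE tr_col.
- by move=> i; rewrite leqNgt -lam1E => /(proj1 (colP i)).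
Qed.

Lemma interpolable_sufficient (R : realType) N K (S : 'M[R]_N) lm lp
    (X Y : 'M[R]_(N, K)) (P := orthproj S)
    (Xp := X - P *m X) (Yp := Y - P *m Y) :
  lm <= lp -> lp < 1 -> P *m X = P *m Y ->
  nsd ((Yp - lm *: Xp)^T *m (Yp - lp *: Xp)) -> Xp^T *m Yp = Yp^T *m Xp ->
  interpolable S lm lp X Y.
Proof.
move=> lmp lp1 PXY nsdA symXY.
have PP : P *m P = P by exact: orthproj_idem.
have PXp : P *m Xp = 0 by rewrite mulmxBr mulmxA PP subrr.
have PYp : P *m Yp = 0 by rewrite mulmxBr mulmxA PP subrr.
have XpE : X - P *m X = Xp by [].
have YpE : Y - P *m Y = Yp by [].
clearbody Xp Yp.
pose A := Yp - lm *: Xp.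
have PA : P *m A = 0 by rewrite mulmxBr -scalemxAr PXp PYp scaler0 subr0.
have AT : A^T = Yp^T - lm *: Xp^T.
  by rewrite /A [LHS]linearB /= [(_ *: _)^T]linearZ.
have symG : A^T *m Xp = Xp^T *m A.
  by rewrite AT mulmxBl mulmxBr -symXY -scalemxAl -scalemxAr.
have [|C [AC symC] leC] := contractive_completion (delta := lp - lm) symG.
  move=> v; have := nsdA v; rewrite -/A.
  (* This turns the semidefinite condition into A^T A <= (lp - lm) Xp^T A, the bound the completion
     requires. *)
  have -> : Yp - lp *: Xp = A - (lp - lm) *: Xp.
    by rewrite /A scalerBl opprB addrA subrK.
  rewrite mulmxBr -scalemxAr symG mulmxBr mulmxBl -scalemxAr -scalemxAl.
  move: (v^T *m (A^T *m A) *m v) (v^T *m (Xp^T *m A) *m v) => a b.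
  by rewrite !mxE subr_le0.
pose Q := A *m C; rewrite -/Q in AC symC leC.
have PQ : P *m Q = 0 by rewrite mulmxA PA mul0mx.
have QP : Q *m P = 0.
  by apply: trmx_inj; rewrite trmx_mul symC orthproj_tr PQ trmx0.
pose M := P + lm *: (1%:M - P) + Q.
exists M; split.
  apply: eigen_MS => //.
  - rewrite /M [(_ + Q)^T]linearD /= [(P + _)^T]linearD /=.
    rewrite [(_ *: _)^T]linearZ /=.
    by rewrite [(_ - _)^T]linearB /= trmx1 orthproj_tr symC.
  - by rewrite /M !mulmxDl QP -scalemxAl mulmxBl mul1mx -/P PP subrr
    scaler0 !addr0.
  move=> u a u0 Pu Mu; rewrite -/P in Pu.
  (* On the complement of [S], [M] acts as [lm] plus [Q]. *)
  have Qu : Q *m u = (a - lm) *: u.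
    have := Mu; rewrite /M !mulmxDl Pu -scalemxAl mulmxBl mul1mx Pu add0r subr0.
    by rewrite scalerBl => <-; rewrite addrC addKr.
  have uu : 0 < (u^T *m u) 0 0 by rewrite lt0r dotmx_eq0 u0 dotmx_ge0.
  have := leC u; rewrite -mulmxA Qu [(_ *: _)^T]linearZ /=
    -scalemxAl -!scalemxAr.
  rewrite scalerA; move: (u^T *m u) uu => c uu.
  rewrite !mxE mulrA ler_pM2r // => le1.
  (* Here (a - lm)^2 <= (lp - lm)(a - lm): a positive a - lm cancels, while otherwise the right side
     is nonpositive and a = lm. *)
  have [c0|c0] := ltrP 0 (a - lm); first by rewrite ler_pM2r // in le1; lra.
  have : (a - lm) * (a - lm) <= 0.
    by rewrite (le_trans le1) // mulr_ge0_le0 // subr_ge0.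
  rewrite -expr2 => le2; have : a - lm == 0.
    by rewrite -sqrf_eq0 eq_le le2 sqr_ge0.
  by rewrite subr_eq0 => /eqP ->; rewrite lexx.
move=> k; rewrite !colE mulmxA; congr (_ *m _).
have QX : Q *m X = A by rewrite -[RHS]AC -XpE mulmxBr mulmxA QP mul0mx subr0.
rewrite /M !mulmxDl QX -scalemxAl mulmxBl mul1mx XpE /A PXY -YpE.
by rewrite -addrA [_ + (_ - _)]addrC subrK addrC subrK.
Qed.

Theorem theorem2 (R : realType) (n d K : nat) (S : 'M[R]_(n * d))
  (lm lp : R) (X Y : 'M[R]_(n * d, K)) :
  (1 <= n)%N -> (1 <= d)%N ->
  -1 < lm -> lm <= lp -> lp < 1 ->
  let Xb := orthproj S *m X in
  let Yb := orthproj S *m Y in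
  let Xp := X - Xb in
  let Yp := Y - Yb in
  interpolable S lm lp X Y <->
  [/\ Xb = Yb,
      nsd ((Yp - lm *: Xp)^T *m (Yp - lp *: Xp)) &
      Xp^T *m Yp = Yp^T *m Xp].
Proof.
move=> _ _ _ lmp lp1 Xb Yb Xp Yp; split; last first.
  by case=> XYb nsdXY symXY; exact: interpolable_sufficient.
case=> M [MSM YE]; have [PM MP] := orthproj_mulMS MSM.
have {}YE : Y = M *m X by apply: eq_col => k; rewrite YE !colE mulmxA.
have YbE : Yb = Xb by rewrite /Yb YE mulmxA PM.
have YpE : Yp = M *m Xp by rewrite /Yp YbE mulmxBr mulmxA MP YE.
split=> //; last by rewrite YpE trmx_mul (proj1 MSM) mulmxA.
(* The matrix form at [v] is the quadratic form of [M] at [Xp *m v], a vector orthogonal to [S]. *)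
move=> v; have PXv : orthproj S *m (Xp *m v) = 0.
  by rewrite mulmxA mulmxBr mulmxA orthproj_idem subrr mul0mx.
have := MS_quadratic_le0 MSM PXv.
by rewrite !mulmxA -YpE !scalemxAl -!mulmxBl trmx_mul !mulmxA.
Qed.
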